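(* Let $D$ be a (weakly connected) Eulerian ribbon digraph, and let $\overrightarrow{uv}$ and $\overrightarrow{wz}$ be arbitrary edges of $D$ (some of $u,v,w,z$ may coincide). Let $x\in S(D)$ and let $\mathcal{E}$, $\mathcal{E}'$ be Eulerian tours of $D$ compatible with the ribbon structure. If $$r_u\big(x, A_{\overrightarrow{uv}}(\mathcal{E})\big)=A_{\overrightarrow{uv}}(\mathcal{E}'),$$ then $$r_w\big(x, A_{\overrightarrow{wz}}(\mathcal{E})\big)=A_{\overrightarrow{wz}}(\mathcal{E}').$$
   Context: A ribbon digraph is a finite directed multigraph $D=(V,E)$ (loops and multiple edges allowed) together with, at each vertex $v$, a cyclic ordering of all edge-ends (in- and out-) incident to $v$. $D$ is Eulerian if in-degree equals out-degree at every vertex; $D$ is assumed weakly connected. For an out-edge $e$ of $v$, ${\rm nextout}(v,e)$ is the next out-edge of $v$ after $e$ in the cyclic order at $v$. An Eulerian tour is a cyclic ordering of $E$ in which the head of each edge equals the tail of the following edge (no distinguished starting point). It is compatible with the ribbon structure if for every vertex $v$, the cyclic order in which the tour traverses the out-edges of $v$ agrees with the cyclic order of the out-edges of $v$ induced by the ribbon structure (nothing is required about in-edges). ${\rm Arb}(D,v)$ denotes the set of spanning in-arborescences rooted at $v$ (spanning trees of the underlying graph in which every vertex has a directed path to $v$). For a compatible tour $\mathcal{E}$ and an edge $\overrightarrow{vw}$, $A_{\overrightarrow{vw}}(\mathcal{E})$ is obtained by reading $\mathcal{E}$ with $\overrightarrow{vw}$ as its first edge and taking, for every vertex $u\neq v$,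 the out-edge of $u$ traversed last; this is an element of ${\rm Arb}(D,v)$, and $\mathcal{E}\mapsto A_{\overrightarrow{vw}}(\mathcal{E})$ is a bijection from compatible Eulerian tours to ${\rm Arb}(D,v)$. Chip configurations are vectors $x\in\mathbb{Z}^V$; $\mathbb{Z}^V_0$ is the subgroup of vectors with coordinate sum $0$. Firing $v$ decreases $x(v)$ by the out-degree of $v$ and increases $x(w)$ by the number of edges $\overrightarrow{vw}$. $x\sim y$ if $y$ is obtained from $x$ by a sequence of firings. The sandpile group is $S(D)=\mathbb{Z}^V_0/\sim$. A rotor configuration $\varrho$ assigns to each vertex $v$ an out-edge $\varrho(v)$ with tail $v$. A routing at $v$ on a pair $(x,\varrho)$ replaces $\varrho(v)$ by $\varrho'(v)={\rm nextout}(v,\varrho(v))$ and replaces $x$ by $x-\mathbf{1}_v+\mathbf{1}_{v'}$, where $v'$ is the head of $\varrho'(v)$; the routing is legal if $x(v)>0$. Two pairs are linearly equivalent, $(x_1,\varrho_1)\sim(x_2,\varrho_2)$, if one is reachable from the other by a sequence of (not necessarily legal) routings. Rotor-routing action $r_v$ of $S(D)$ on ${\rm Arb}(D,v)$ (Holroyd et al.): for $x\in S(D)$ and $T\in{\rm Arb}(D,v)$, choose a representative $x'\sim x$ with $x'(u)\ge 0$ for all $u\neq v$, an out-edge $\overrightarrow{vw}$, and start from $(x',T\cup\{\overrightarrow{vw}\})$; perform legal routings at vertices other than $v$ until all chips are at $v$. The final rotors at vertices $u\neq v$ form an arborescence in ${\rm Arb}(D,v)$, which is $r_v(x,T)$;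 this is well defined and is a simply transitive group action. Equivalently, $r_v(x,T)=T'$ iff $(x,T\cup\{\overrightarrow{vw}\})\sim(\mathbf{0},T'\cup\{\overrightarrow{vw}\})$ for an (any) out-edge $\overrightarrow{vw}$ of $v$. *)

(* Defs.v *)
From HB Require Import structures.
From mathcomp Require Import all_boot all_order all_algebra perm.
From Stdlib Require Import ClassicalEpsilon.

Set Implicit Arguments.
Unset Strict Implicit.
Unset Printing Implicit Defensive.

Import GRing.Theory Num.Theory.
Local Open Scope ring_scope.

(* The edge-ends of a digraph are encoded as pairs [(e, b)]: [(e, true)] is the
   out-end of [e], incident to its tail, and [(e, false)] is its in-end,
   incident to its head. A loop thus has two distinct ends at its vertex. *)
Definition end_vertex (V E : finType) (tail head : E -> V) (a : E * bool) : V :=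
  if a.2 then tail a.1 else head a.1.

(* Cyclic orderings are given by their successor permutation: the cycles of
   [ribbon] are exactly the sets of edge-ends incident to a common vertex. *)
Record ribbon_digraph := RibbonDigraph {
  vertex : finType;
  edge : finType;
  tail : edge -> vertex;
  head : edge -> vertex;
  ribbon : {perm edge * bool};
  ribbonP : forall a b : edge * bool,
    (b \in orbit ribbon a) = (end_vertex tail head a == end_vertex tail head b)
}.
Arguments tail {r} _.
Arguments head {r} _.

Section RibbonDigraph.
Variable D : ribbon_digraph.
Notation V := (vertex D).
Notation E := (edge D).
Implicit Types (T : {set E}) (u v w : V) (e f : E).

Definition arc T : rel V :=
  [rel u v | [exists e in T, (tail e == u) && (head e == v)]].

Definition adj T : rel V := [rel u v | arc T u v || arc T v u].

Definition weakly_connected : Prop := forall u v, connect (adj [set: E]) u v.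

Definition outdeg v : nat := #|[set e : E | tail e == v]|.

Definition indeg v : nat := #|[set e : E | head e == v]|.

Definition eulerian : Prop := forall v, indeg v = outdeg v.

(* The cyclic order induced by the ribbon structure on the out-edges of
   [tail e], listed from [e] on. *)
Definition out_order e : seq E :=
  [seq a.1 | a <- orbit (ribbon D) (e, true) & a.2].

(* nextout(v, e), where v is necessarily [tail e] *)
Definition nextout e : E := next (out_order e) e.

(* A cycle of the underlying undirected multigraph is a cyclic sequence of
   pairs [(e, b)], where [b] tells whether [e] is followed forwards; both its
   edges and its vertices are distinct, so that loops and pairs of parallel
   edges are cycles, but an edge followed back and forth is not. *)
Definition dart_src (d : E * bool) : V := if d.2 then tail d.1 else head d.1.
Definition dart_tgt (d : E * bool) : V := if d.2 then head d.1 else tail d.1.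

Definition graph_cycle T (c : seq (E * bool)) : bool :=
  [&& c != [::], all (fun d => d.1 \in T) c,
      cycle [rel d d' | dart_tgt d == dart_src d'] c,
      uniq [seq d.1 | d <- c] & uniq [seq dart_src d | d <- c]].

Definition spanning_tree T : Prop :=
  (forall u v, connect (adj T) u v) /\ (forall c, ~~ graph_cycle T c).

Definition in_arborescence v T : Prop :=
  spanning_tree T /\ forall u, connect (arc T) u v.

Record arb v := Arb {
  arb_edges :> {set E};
  arbP : in_arborescence v arb_edges
}.

(* A tour is again given by the successor permutation of a cyclic ordering of
   all the edges. *)
Record euler_tour := EulerTour {
  tour_next : {perm E};
  tour_transitive : forall e f, f \in orbit tour_next e;
  tour_chain : forall e, head e = tail (tour_next e)
}.

(* The tour, read from [e] on. *)
Definition reading (t : euler_tour) e : seq E := orbit (tour_next t) e.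

Definition compatible (t : euler_tour) : Prop :=
  forall e, next [seq f <- reading t e | tail f == tail e] e = nextout e.

(* The last out-edges, at the vertices other than [tail e], of the reading of
   the tour from [e] on. *)
Definition last_exits (t : euler_tour) e : {set E} :=
  [set f | (tail f != tail e) &&
           (last f [seq g <- reading t e | tail g == tail f] == f)].

Lemma mem_reading t e f : f \in reading t e.
Proof. exact: tour_transitive. Qed.

Lemma uniq_reading t e : uniq (reading t e).
Proof. exact: orbit_uniq. Qed.

Lemma index_last_filter (P : pred E) (s : seq E) f g : uniq s ->
  g \in s -> P g -> (index g s <= index (last f [seq h <- s | P h]) s)%N.
Proof.
elim: s f => [|y s IHs] //= f /andP[ys us].
rewrite inE eq_sym; case: eqP => [//|_] /= gs Pg.
case: (P y) => /=; first case: eqP => [yl|_].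
- have: y \in s.
    rewrite [in y]yl; have: g \in [seq h <- s | P h] by rewrite mem_filter Pg.
    case E1: [seq h <- s | P h] => [//|z r] _ /=.
    have: last z r \in [seq h <- s | P h] by rewrite E1 mem_last.
    by rewrite mem_filter => /andP[].
  by rewrite (negPf ys).
- by rewrite ltnS IHs.
case: eqP => [yl|_]; last by rewrite ltnS IHs.
have: y \in s.
  rewrite [in y]yl; have: g \in [seq h <- s | P h] by rewrite mem_filter Pg.
  case E1: [seq h <- s | P h] => [//|z r] _ /=.
  have: last z r \in [seq h <- s | P h] by rewrite E1 mem_last.
  by rewrite mem_filter => /andP[].
by rewrite (negPf ys).
Qed.

Lemma mem_last_exits t e f : f \in last_exits t e ->
  tail f != tail e /\
  forall g, tail g = tail f ->
    (index g (reading t e) <= index f (reading t e))%N.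
Proof.
rewrite inE => /andP[fe /eqP fl]; split=> // g gf; rewrite -[in leqRHS]fl.
apply: index_last_filter (uniq_reading t e) (mem_reading t e g) _.
by rewrite gf.
Qed.

Lemma last_exits_tail_inj t e f g : f \in last_exits t e ->
  g \in last_exits t e -> tail f = tail g -> f = g.
Proof.
move=> /mem_last_exits[_ fm] /mem_last_exits[_ gm] fg.
have fr := mem_reading t e f.
rewrite -(nth_index f fr) -[RHS](nth_index f (mem_reading t e g)).
by congr nth; apply/eqP; rewrite eqn_leq gm // fm.
Qed.

Lemma last_exits_ex t e f : tail f != tail e ->
  exists2 g, g \in last_exits t e & tail g = tail f.
Proof.
move=> fe; set s := [seq g <- reading t e | tail g == tail f].
have fs : f \in s by rewrite mem_filter eqxx mem_reading.
have ls : last f s \in s by case: (s) fs => // a r _; exact: (mem_last a r).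
have lf : tail (last f s) = tail f.
  by move: ls; rewrite mem_filter => /andP[/eqP].
exists (last f s) => //; rewrite inE lf fe /=; apply/eqP.
by rewrite -/s; case: (s) fs.
Qed.

Lemma index_tour_next t e f : tour_next t f != e ->
  index (tour_next t f) (reading t e) = (index f (reading t e)).+1.
Proof.
set p := tour_next t => pe.
have fr := mem_reading t e f; rewrite /reading -/p in fr *.
have ef : fconnect p e f by rewrite fconnect_orbit.
have i1 : (findex p e f).+1 = findex p e (p f).
  have lt := findex_max ef; move: (lt); rewrite leq_eqVlt => /orP[/eqP eo|lt2].
    move: pe; rewrite -(iter_findex ef) -iterS eo.
    by rewrite (iter_order (@perm_inj _ p)) eqxx.
  by rewrite -{2}(iter_findex ef) -iterS findex_iter.
exact: (esym i1).
Qed.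

Lemma last_exits_lt t e f g : f \in last_exits t e ->
  g \in last_exits t e -> head f = tail g ->
  (index f (reading t e) < index g (reading t e))%N.
Proof.
move=> fT gT fg; have [ge gm] := mem_last_exits gT.
have ng : tail (tour_next t f) = tail g by rewrite -tour_chain.
rewrite -index_tour_next ?gm //; apply: contraNneq ge => ne.
by rewrite -ng ne.
Qed.

Lemma last_exits_cover t e u : weakly_connected -> u != tail e ->
  exists2 g, g \in last_exits t e & tail g = u.
Proof.
move=> conn ue.
have [f fu] : exists f, tail f = u.
  case/connectP: (conn u (tail e)) => -[|w p] /=.
    by move=> _ eu; rewrite eu eqxx in ue.
  case/andP=> /orP[] /exists_inP[f _ /andP[/eqP tf /eqP hf]] _ _.
    by exists f.
  by exists (tour_next t f); rewrite -tour_chain.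
by rewrite -fu; apply: last_exits_ex; rewrite fu.
Qed.

Lemma last_exits_reach t e u : weakly_connected ->
  connect (arc (last_exits t e)) u (tail e).
Proof.
move=> conn; have [->|ue] := eqVneq u (tail e); first exact: connect0.
have [g gT <-] := last_exits_cover t conn ue.
have [n] := ubnP (size (reading t e) - index g (reading t e)).
elim: n => // n IHn in g gT *; rewrite ltnS => gn.
have gh : arc (last_exits t e) (tail g) (head g).
  by apply/exists_inP; exists g; rewrite ?eqxx.
apply: connect_trans (connect1 gh) _.
have [->|he] := eqVneq (head g) (tail e); first exact: connect0.
have [h hT hg] := last_exits_cover t conn he.
rewrite -hg; apply: IHn => //; apply: leq_trans gn.
apply: ltn_sub2l; first by rewrite index_mem mem_reading.
by apply: last_exits_lt.
Qed.

Lemma last_exits_acyclic t e c : ~~ graph_cycle (last_exits t e) c.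
Proof.
apply/negP=> /and5P[c0 /allP cT cyc uc _].
have {c0} [d0 d0c] : exists d, d \in c.
  by case: c c0 {cT cyc uc} => // d c _; exists d; rewrite mem_head.
pose m (d : E * bool) := index d.1 (reading t e).
have [d dc dmin] : exists2 d, d \in c & forall d', d' \in c -> (m d <= m d')%N.
  by case: (arg_minnP m d0c) => d dc dmin; exists d.
have cinj d' : d' \in c -> d'.1 = d.1 -> d' = d.
  move=> d'c dd; rewrite -(nth_index d d'c) -[RHS](nth_index d dc).
  congr nth; apply: (uniqP d.1 uc); rewrite ?inE ?size_map ?index_mem //.
  by rewrite !(nth_map d) ?index_mem // !nth_index.
have no_in d' : d' \in c -> head d'.1 != tail d.1.
  move=> d'c; apply/eqP => /(last_exits_lt (cT _ d'c) (cT _ dc)).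
  by rewrite ltnNge dmin.
have same d' : d' \in c -> tail d.1 = tail d'.1 -> d' = d.
  move=> d'c dd; apply: cinj => //.
  exact: last_exits_tail_inj (cT _ d'c) (cT _ dc) (esym dd).
case bd: d.2.
- have pc : prev c d \in c by rewrite mem_prev.
  have := prev_cycle cyc dc; rewrite /= /dart_tgt /dart_src bd.
  case bp: (prev c d).2 => /eqP pd; first by have /eqP[] := no_in _ pc.
  by move: (same _ pc (esym pd)) bp => ->; rewrite bd.
- have nc : next c d \in c by rewrite mem_next.
  have := next_cycle cyc dc; rewrite /= /dart_tgt /dart_src bd.
  case bn: (next c d).2 => /eqP pd; last by have /eqP[] := no_in _ nc.
  by move: (same _ nc pd) bn => ->; rewrite bd.
Qed.

Lemma last_exits_arborescence t e : weakly_connected ->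
  in_arborescence (tail e) (last_exits t e).
Proof.
move=> conn; split; last by move=> u; apply: last_exits_reach.
split; last exact: last_exits_acyclic.
have sub u v : connect (arc (last_exits t e)) u v ->
    connect (adj (last_exits t e)) u v.
  by apply: connect_sub => a b ab; apply: connect1; apply/orP; left.
have sym : connect_sym (adj (last_exits t e)).
  by apply: sym_connect_sym => a b; apply: orbC.
move=> u v; apply: connect_trans (sub _ _ (last_exits_reach t e u conn)) _.
by rewrite sym; apply/sub/last_exits_reach.
Qed.

Definition tour_arb (conn : weakly_connected) e (t : euler_tour) :
    arb (tail e) :=
  Arb (last_exits_arborescence t e conn).

Definition config := {ffun V -> int}.
Implicit Types (x y : config).

Definition fire v x : config :=
  [ffun w => x w - (if w == v then outdeg v else 0%N)%:Z
                 + #|[set e : E | (tail e == v) && (head e == w)]|%:Z].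

Definition firing_equiv x y : Prop :=
  exists s : seq V, y = foldl (fun z v => fire v z) x s.

(* The elements of the sandpile group: the classes of [firing_equiv] (an
   equivalence relation when [D] is Eulerian) among the configurations of
   total sum 0. *)
Record sandpile := Sandpile {
  sandpile_class :> config -> Prop;
  sandpileP : exists2 x : config, \sum_v x v = 0 &
                forall y, sandpile_class y <-> firing_equiv x y
}.

Definition rotor_config (rho : {ffun V -> E}) : Prop :=
  forall v, tail (rho v) = v.

Definition state := (config * {ffun V -> E})%type.

Definition route v (s : state) : state :=
  let e := nextout (s.2 v) in
  ([ffun u => s.1 u - (u == v)%:Z + (u == head e)%:Z],
   [ffun u => if u == v then e else s.2 u]).

(* Reachability by legal routings at vertices other than [v]. *)
Inductive legal_routings v : state -> state -> Prop :=
| legal_refl s : legal_routings v s s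
| legal_step u (s s' : state) : u != v -> 0 < s.1 u ->
    legal_routings v (route u s) s' -> legal_routings v s s'.

(* [T'] is the outcome of some run of the rotor-routing procedure: [x] is the
   chosen representative of [X], [e] the chosen out-edge of the root. *)
Definition rotor_outcome v (X : sandpile) (T T' : arb v) : Prop :=
  exists (x y : config) (rho rho' : {ffun V -> E}) (e : E),
    [/\ X x /\ (forall u, u != v -> 0 <= x u),
        tail e = v,
        rotor_config rho /\ [set rho u | u : V] = e |: T,
        legal_routings v (x, rho) (y, rho') /\ (forall u, u != v -> y u = 0)
      & T' = [set rho' u | u in [set~ v]] :> {set E}].

(* The rotor-routing action r_v. If [D] is weakly connected and Eulerian and [v] has
   an out-edge, an outcome exists and does not depend on the choices made in
   [rotor_outcome], so the default value of [epsilon] is not used. *)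
Definition rotor_action v (X : sandpile) (T : arb v) : arb v :=
  epsilon (inhabits T) (rotor_outcome X T).

End RibbonDigraph.

(* Main.v *)
(* Routing is tracked modulo linear equivalence, i.e. up to routings and inverse
   routings that may be illegal.  Right after a compatible tour has traversed
   [e], let every rotor point to the out-edge its vertex was last left by, and
   put one chip on [head e].  Routing that chip moves it along the next edge of
   the tour, and compatibility says that the rotor it turns is again the last
   exit; so the class of this chip-and-rotors state depends on the tour only.
   Off [tail e] these rotors form [last_exits t e], hence the equivalence
   (x, A_uv(t) + uv) ~ (0, A_uv(t') + uv) shifted by a chip at [head uv] turns
   into the one for [wz].  Finally, an outcome of the rotor-routing procedure
   is an arborescence linearly equivalent to the start; it exists, because legal
   routing stops, and it is unique: if the routings from one arborescence to
   another turn the rotors of the vertices of [U] forwards and the others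
   backwards or not at all, with the root outside [U], then conservation of
   chips on [U] forbids any chip to leave [U], so the final rotors of [U] stay
   in [U] and do not lead to the root. *)
Require Import Defs.
From mathcomp Require Import all_boot all_order all_algebra perm.
From mathcomp Require Import zify ring lra.
From Stdlib Require Import Classical ClassicalEpsilon.
Import Defs.

Set Implicit Arguments.
Unset Strict Implicit.
Unset Printing Implicit Defensive.

Import Order.TTheory GRing.Theory Num.Theory.
Local Open Scope ring_scope.

(** * Rotations and successors in cyclic lists *)

Lemma filter_rot (T : Type) (P : pred T) i (s : seq T) :
  exists j, [seq x <- rot i s | P x] = rot j [seq x <- s | P x].
Proof.
exists (size [seq x <- take i s | P x]).
by rewrite -{3}(cat_take_drop i s) filter_cat rot_size_cat -filter_cat.
Qed.

Lemma orbit_perm_rot (T : finType) (p : {perm T}) x y :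
  y \in orbit p x -> exists i, orbit p y = rot i (orbit p x).
Proof.
move=> yx; have c := cycle_orbit (@perm_inj _ p) x.
by have [i] := orbit_rot_cycle c (orbit_uniq p x) yx; exists i.
Qed.

Lemma next_index (T : eqType) (s : seq T) x : uniq s -> x \in s ->
  index (next s x) s =
    (if (index x s).+1 == size s then 0 else (index x s).+1)%N.
Proof.
move=> us xs; have := xs; rewrite -index_mem next_nth xs.
case: s us xs => // y s us _; set i := index x _;
  rewrite [size _]/= ltnS eqSS => le.
case: eqP => [->|ne]; first by rewrite nth_default //= eqxx.
by rewrite -[nth y s i]/(nth y (y :: s) i.+1) index_uniq //= ltnS ltn_neqAle le
  andbT; apply/eqP.
Qed.

Lemma next_last (T : eqType) (x : T) s :
  uniq (x :: s) -> next (x :: s) (last x s) = x.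
Proof.
move=> us; rewrite next_nth mem_last nth_default //.
by rewrite index_last.
Qed.

(** * Numbering the out-edges of a vertex *)

Section Ribbon.
Variable D : ribbon_digraph.
Notation V := (vertex D).
Notation E := (edge D).

Lemma mem_out_order (e f : E) : (f \in out_order e) = (tail f == tail e).
Proof.
apply/mapP/eqP => [[[g b]]|fe].
  by rewrite mem_filter ribbonP /end_vertex => /andP[/= -> /eqP ->] ->.
by exists (f, true) => //; rewrite mem_filter /= ribbonP /end_vertex /= fe.
Qed.

Lemma uniq_out_order (e : E) : uniq (out_order e).
Proof.
rewrite map_inj_in_uniq ?filter_uniq ?orbit_uniq //.
by move=> [a b] [a' b']; rewrite !mem_filter /= => /andP[-> _] /andP[-> _] ->.
Qed.

(** The cyclic order at [v] is cut open at an arbitrary out-edge, so that [rank_out] numbers the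
    out-edges and [nextout] adds 1 to the number or wraps around to 0. *)
Definition outs (v : V) : seq E :=
  if [pick e | tail e == v] is Some e then out_order e else [::].

Definition rank_out (f : E) : nat := index f (outs (tail f)).

Lemma mem_outs (v : V) (f : E) : (f \in outs v) = (tail f == v).
Proof.
rewrite /outs; case: pickP => [e /eqP <-|/(_ f) -> //].
exact: mem_out_order.
Qed.

Lemma uniq_outs v : uniq (outs v).
Proof. by rewrite /outs; case: pickP => // e _; apply: uniq_out_order. Qed.

(** Orbits read from two out-ends of one vertex are rotations of each other; filtering keeps this,
    and [next] is invariant under rotation. *)
Lemma nextout_outs (e : E) : nextout e = next (outs (tail e)) e.
Proof.
rewrite /outs; case: pickP => [b /eqP be|/(_ e)]; last by rewrite eqxx.
have /orbit_perm_rot[i ei] : (e, true) \in orbit (ribbon D) (b, true).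
  by rewrite ribbonP /end_vertex /= be.
rewrite /nextout {1}/out_order ei;
  have [j ->] := filter_rot snd i (orbit (ribbon D) (b, true)).
by rewrite map_rot next_rot // -/(out_order b) uniq_out_order.
Qed.

Lemma tail_nextout (e : E) : tail (nextout e) = tail e.
Proof. by apply/eqP; rewrite -mem_outs nextout_outs mem_next mem_outs. Qed.

Lemma rank_out_lt (f : E) : (rank_out f < size (outs (tail f)))%N.
Proof. by rewrite index_mem mem_outs. Qed.

Lemma rank_out_inj (f g : E) : tail f = tail g -> rank_out f = rank_out g -> f =
  g.
Proof.
rewrite /rank_out => fg; rewrite -fg => eq_fg.
have fs : f \in outs (tail f) by rewrite mem_outs.
rewrite -(nth_index f fs) eq_fg nth_index // mem_outs fg //.
Qed.

Lemma rank_out_nextout (e : E) : rank_out (nextout e) =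
  (if (rank_out e).+1 == size (outs (tail e)) then 0 else (rank_out e).+1)%N.
Proof.
by rewrite /rank_out tail_nextout nextout_outs next_index ?uniq_outs ?mem_outs.
Qed.

End Ribbon.

(** * Linear equivalence as a balance of chips *)

Section LinearEquivalence.
Variable D : ribbon_digraph.
Notation V := (vertex D).
Notation E := (edge D).
Implicit Types (rho : {ffun V -> E}) (x y z : config D) (s : state D).

(** The number of chips (0 or 1) sent along [f] in the current turn of the rotor, a turn starting at
    rank 0. Whole turns are counted separately by the [n] of [lin_equiv]. *)
Definition passed rho (f : E) : int :=
  (rank_out f <= rank_out (rho (tail f)))%N%:Z.

Definition netflow (c : E -> int) (v : V) : int :=
  \sum_(f | head f == v) c f - \sum_(f | tail f == v) c f.

Lemma eq_netflow c c' : c =1 c' -> netflow c =1 netflow c'.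
Proof. by move=> cc v; congr (_ - _); apply: eq_bigr. Qed.

Lemma netflowD c c' v :
  netflow (fun f => c f + c' f) v = netflow c v + netflow c' v.
Proof. by rewrite /netflow !big_split /=; ring. Qed.

Lemma netflowN c v : netflow (fun f => - c f) v = - netflow c v.
Proof. by rewrite /netflow !sumrN; ring. Qed.

Lemma netflow_delta (e : E) v :
  netflow (fun f => (f == e)%:Z) v = (v == head e)%:Z - (v == tail e)%:Z.
Proof.
rewrite /netflow; congr (_ - _).
  have [->|ve] := eqVneq v (head e).
    by rewrite (bigD1 e) //= eqxx big1 ?addr0 // => f /andP[_ /negPf ->].
  by apply: big1 => f /eqP fv; case: eqP => // fe; rewrite -fv fe eqxx in ve.
have [->|ve] := eqVneq v (tail e).
  by rewrite (bigD1 e) //= eqxx big1 ?addr0 // => f /andP[_ /negPf ->].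
by apply: big1 => f /eqP fv; case: eqP => // fe; rewrite -fv fe eqxx in ve.
Qed.

Lemma sum_netflow c : \sum_v netflow c v = 0.
Proof.
rewrite sumrB (exchange_big_dep xpredT) //= [X in _ - X](exchange_big_dep
  xpredT) //=.
rewrite -sumrB big1 // => f _.
by rewrite !(eq_bigl _ _ (eq_sym _)) !big_pred1_eq subrr.
Qed.

(* Some sequence of routings and inverse routings leads from [s] to [s'] iff
   for some number [n v] of full turns of each rotor the chips carried along
   the edges account for the difference of the chip configurations. *)
Definition lin_equiv s s' : Prop := exists n : V -> int, forall v,
  s'.1 v = s.1 v +
    netflow (fun f => n (tail f) + passed s'.2 f - passed s.2 f) v.

Lemma lin_equiv_refl s : lin_equiv s s.
Proof.
exists (fun=> 0) => v; rewrite /netflow !big1 ?subr0 ?addr0 // => f _.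
all: by rewrite add0r subrr.
Qed.

Lemma lin_equiv_sym s s' : lin_equiv s s' -> lin_equiv s' s.
Proof.
case=> n h; exists (fun v => - n v) => v; rewrite h -addrA -netflowD.
rewrite (_ : netflow _ v = 0) ?addr0 // /netflow !big1 ?subr0 // => f _.
all: ring.
Qed.

Lemma lin_equiv_trans s s' s'' :
  lin_equiv s s' -> lin_equiv s' s'' -> lin_equiv s s''.
Proof.
case=> n h [n' h']; exists (fun v => n v + n' v) => v.
rewrite h' h -addrA -netflowD; congr (_ + _).
by apply: eq_netflow => f; ring.
Qed.

Lemma lin_equiv_shift x y z rho rho' :
  lin_equiv (x, rho) (y, rho') -> lin_equiv (x + z, rho) (y + z, rho').
Proof. by case=> n h; exists n => v; rewrite !ffunE h /=; ring. Qed.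

(** When both states have the same rotor at [v], the [passed] terms of the out-edges of [v] cancel,
    so this common rotor may be exchanged for any other. *)
Lemma lin_equiv_root v x y (rho rho' tau tau' : {ffun V -> E}) :
    (forall u, u != v -> rho u = tau u) ->
    (forall u, u != v -> rho' u = tau' u) ->
    rho v = rho' v -> tau v = tau' v ->
  lin_equiv (x, rho) (y, rho') -> lin_equiv (x, tau) (y, tau').
Proof.
move=> e1 e2 e3 e4 [n h]; exists n => u; rewrite h /=; congr (_ + _).
apply: eq_netflow => f; rewrite /passed.
have [->|fv] := eqVneq (tail f) v; first by rewrite e3 e4; ring.
by rewrite e1 ?e2.
Qed.

Lemma sum_lin_equiv s s' :
  lin_equiv s s' -> \sum_v s'.1 v = \sum_v s.1 v.
Proof.
by case=> n h; rewrite (eq_bigr _ (fun v _ =>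
  h v)) big_split /= sum_netflow addr0.
Qed.

Lemma passed_route v s : rotor_config s.2 ->
  exists b : bool, forall f, passed (route v s).2 f =
    passed s.2 f + (f == nextout (s.2 v))%:Z - (b && (tail f == v))%:Z.
Proof.
(* [b] tells whether the rotor completes a turn, which resets [passed] on all out-edges of [v]. *)
move=> rc; exists ((rank_out (s.2 v)).+1 == size (outs v)) => f.
rewrite /passed /= ffunE; have [fv|fv] := eqVneq (tail f) v; last first.
  rewrite andbF subr0; case: eqP => [fe|]; last by rewrite addr0.
  by rewrite fe tail_nextout rc eqxx in fv.
have := rank_out_lt f; have := rank_out_lt (s.2 v).
rewrite fv andbT rank_out_nextout rc.
have -> : (f == nextout (s.2 v)) = (rank_out f == rank_out (nextout (s.2 v))).
  apply/eqP/eqP => [-> //|]; apply: rank_out_inj.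
  by rewrite tail_nextout rc.
by rewrite rank_out_nextout rc; case: eqP => /= *; lia.
Qed.

Lemma lin_equiv_route v s : rotor_config s.2 -> lin_equiv s (route v s).
Proof.
move=> rc; have [b hb] := passed_route v rc.
exists (fun u => (b && (u == v))%:Z) => u.
rewrite (eq_netflow (c' := fun f => (f == nextout (s.2 v))%:Z)); last first.
  by move=> f; rewrite hb; ring.
by rewrite netflow_delta ffunE tail_nextout rc; ring.
Qed.

Lemma rotor_config_route v s : rotor_config s.2 -> rotor_config (route v s).2.
Proof.
by move=> rc u; rewrite ffunE; case: eqP => // ->; rewrite tail_nextout.
Qed.

Lemma fireE v x u : fire v x u = x u + netflow (fun f => (tail f == v)%:Z) u.
Proof.
rewrite ffunE -addrA; congr (_ + _); rewrite addrC /netflow; congr (_ - _).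
  rewrite -sum1_card -natz natr_sum /= [LHS]big_mkcond [RHS]big_mkcond /=.
  by apply: eq_bigr => f _; rewrite inE; do 2 case: eqP.
case: (eqVneq u v) => [->|uv]; last first.
  by rewrite big1 // => f /eqP ->; rewrite (negPf uv).
rewrite /outdeg -sum1_card -natz natr_sum /= [LHS]big_mkcond [RHS]big_mkcond /=.
by apply: eq_bigr => f _; rewrite inE; case: eqP.
Qed.

(** Firing [v] is one full turn of the rotor at [v]. *)
Lemma lin_equiv_fire v x rho : lin_equiv (x, rho) (fire v x, rho).
Proof.
exists (fun u => (u == v)%:Z) => u; rewrite /= fireE; congr (_ + _).
by apply: eq_netflow => f; rewrite addrK.
Qed.

Lemma lin_equiv_fires x y rho : firing_equiv x y -> lin_equiv (x, rho) (y, rho).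
Proof.
case=> l ->; elim: l x => [|v l IHl] x /=; first exact: lin_equiv_refl.
exact: lin_equiv_trans (lin_equiv_fire v x rho) (IHl _).
Qed.

Lemma legal_routings_lin_equiv v s s' : legal_routings v s s' ->
  rotor_config s.2 -> [/\ lin_equiv s s', rotor_config s'.2 & s'.2 v = s.2 v].
Proof.
elim=> [{}s rc|u {}s {}s' uv _ _ IHr rc].
  by split=> //; apply: lin_equiv_refl.
have [le rc' sv] := IHr (rotor_config_route u rc).
split=> //; first exact: lin_equiv_trans (lin_equiv_route u rc) le.
by rewrite sv ffunE eq_sym (negPf uv).
Qed.

End LinearEquivalence.

(** * Distances and a rapidly decaying weight *)

Lemma connect_rank (T : finType) (R : rel T) (r : T) :
    (forall u, connect R r u) ->
  exists2 rank : T -> nat, rank r = 0%N &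
    forall u, u != r -> exists2 w, R w u & (rank w < rank u)%N.
Proof.
move=> conn; pose P u n := [exists p : n.-tuple T, path R r p && (last r p ==
  u)].
have exP u : exists n, P u n.
  have /connectP[p Rp up] := conn u; exists (size p).
  by apply/existsP; exists (in_tuple p); rewrite Rp up eqxx.
exists (fun u => ex_minn (exP u)).
  case: ex_minnP => n _ /(_ 0%N); rewrite leqn0 => n0; apply/eqP; apply: n0.
  by apply/existsP; exists [tuple]; rewrite /= eqxx.
move=> u ur; case: ex_minnP => n /existsP[p /andP[]] Rp rp _.
move: Rp rp.
have := size_tuple p; case/lastP: (tval p) => [|q w] sq /=.
  by move=> _ /eqP ru; rewrite ru eqxx in ur.
rewrite rcons_path last_rcons => /andP[Rq Rw] /eqP wu; subst w.
exists (last r q) => //; case: ex_minnP => m _ /(_ (size q)) mq.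
rewrite -sq size_rcons ltnS; apply: mq.
by apply/existsP; exists (in_tuple q); rewrite Rq eqxx.
Qed.

(* [f u = K ^ (N - rank u)] for the distance [rank] from [r] and [K] larger
   than twice the number of edges. *)
Lemma superharmonic_ex (V E : finType) (src dst : E -> V) (r : V) :
    (forall u, connect [rel a b | [exists e, (src e == a) && (dst e == b)]] r u)
      ->
  exists2 f : V -> nat, forall u, (f u <= f r)%N &
    forall u, u != r ->
      (\sum_(e | dst e == u) (f u).+1 <= \sum_(e | dst e == u) f (src e))%N.
Proof.
case/connect_rank=> rank r0 rankP; pose N := (\max_u rank u)%N.
have rN u : (rank u <= N)%N by apply: leq_bigmax.
pose K := (2 * #|E|.+1)%N; exists (fun u => K ^ (N - rank u))%N => u.
  by rewrite leq_pexp2l // r0; lia.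
move=> ur; have [w /existsP[e /andP[/eqP ew eu]] wu] := rankP u ur.
(* The single edge [e] from the closer vertex [w] suffices: its term is at least [K * k], whereas
   the left side is at most [#|E| * (2 * k)]. *)
rewrite sum_nat_const (bigD1 e) //= ew; apply: leq_trans (leq_addr _ _).
have -> : (N - rank w = (N - rank u).+1 + (rank u - rank w).-1)%N by have := rN
  u; lia.
rewrite expnD expnS; set k := (K ^ (N - rank u))%N.
have k1 : (0 < k)%N by rewrite expn_gt0.
apply: leq_trans (leq_pmulr _ _); last by rewrite expn_gt0.
apply: (@leq_trans (#|E| * (2 * k))); first by apply: leq_mul (max_card _) _;
  lia.
by rewrite /K; nia.
Qed.

(** * Uniqueness: equivalent arborescences coincide *)

Section RotorRouting.
Variable D : ribbon_digraph.
Notation V := (vertex D).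
Notation E := (edge D).
Implicit Types (rho : {ffun V -> E}) (x y z : config D) (s : state D).

(* The rotors at the vertices other than [v] form an arborescence rooted at
   [v]. *)
Definition rooted v rho := forall C : {set V}, v \notin C ->
  (forall u, u \in C -> head (rho u) \in C) -> C = set0.

Lemma sum_netflow_set (C : {set V}) (c : E -> int) :
  \sum_(u in C) netflow c u =
  \sum_f c f * ((head f \in C)%:Z - (tail f \in C)%:Z).
Proof.
rewrite sumrB (exchange_big_dep xpredT) //= [X in _ - X](exchange_big_dep
  xpredT) //=.
rewrite -sumrB; apply: eq_bigr => f _; rewrite mulrBr.
have one (w : V) : \sum_(u in C | w == u) c f = c f * (w \in C)%:Z.
  case wC: (w \in C); last first.
    by rewrite mulr0 big1 // => u /andP[uC /eqP wu]; rewrite wu uC in wC.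
  rewrite mulr1 (bigD1 w) /= ?wC ?eqxx // big1 ?addr0 // => u.
  by case/andP=> /andP[_ /eqP ->]; rewrite eqxx.
by rewrite !one.
Qed.

Lemma netflow0 (c : int) v : eulerian D -> netflow (fun _ : E => c) v = 0.
Proof.
move=> eul; rewrite /netflow !sumr_const.
have := eul v; rewrite /indeg /outdeg !cardsE => ->.
by rewrite subrr.
Qed.

Lemma rooted_no_turn v rho rho' (n : V -> int) :
    rotor_config rho' -> rooted v rho' -> rho v = rho' v -> n v = 0 ->
    (forall u,
      netflow (fun f => n (tail f) + passed rho' f - passed rho f) u = 0) ->
  forall u, n u <= 0 /\
    (n u = 0 -> (rank_out (rho' u) <= rank_out (rho u))%N).
Proof.
move=> rc ro ev nv; set c := fun f => _ => c0.
(* [C] collects the vertices whose rotor makes a net advance, compared lexicographically by full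
   turns and then by rank. *)
pose P u := (0 < n u) || (n u == 0) && (rank_out (rho u) < rank_out (rho' u))%N.
pose C := [set u | P u].
suff C0 : C = set0.
  move=> u; have : u \notin C by rewrite C0 inE.
  by rewrite inE negb_or -leNgt => /andP[-> h]; split=> // nu; move: h;
    rewrite nu eqxx /= -leqNgt.
have cin f : tail f \in C -> 0 <= c f.
  rewrite inE /P /c /passed; case/orP=> [np|/andP[/eqP -> lt]].
    by do 2 case: (_ <= _)%N => /=; lia.
  by case: leqP => h1; case: leqP => h2; lia.
have cout f : tail f \notin C -> c f <= 0.
  rewrite inE /P /c /passed negb_or -leNgt => /andP[np h].
  move: h; case: eqP => [-> /=|ne _]; first by rewrite -leqNgt => h;
    case: leqP => h1; case: leqP => h2; lia.
  by do 2 case: (_ <= _)%N => /=; lia.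
have crot u : u \in C -> 0 < c (rho' u).
  rewrite inE /P /c /passed rc leqnn; case/orP=> [np|/andP[/eqP -> lt]].
    by case: (_ <= _)%N => /=; lia.
  by case: leqP => h1; lia.
apply: ro => [|u uC]; first by rewrite inE /P nv ev ltnn.
(* The net flow into [C] is 0 and every edge contributes at most 0 to it. So each contribution
   vanishes, and [rho' u], which carries positive flow, cannot leave [C]. *)
have /eqP := sum_netflow_set C c;
  rewrite big1 // eq_sym -oppr_eq0 -sumrN psumr_eq0.
  move/allP/(_ (rho' u)); rewrite mem_index_enum rc uC => /(_ isT) /=.
  by have := crot u uC; case: (head _ \in C) => //; rewrite /=; lia.
move=> f _; case tC: (tail f \in C).
  by have := cin f tC; case: (head f \in C) => /=; lia.
by have := cout f (negbT tC); case: (head f \in C) => /=; lia.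
Qed.

Lemma rooted_lin_equiv_inj v x rho rho' : eulerian D ->
    rotor_config rho -> rotor_config rho' -> rooted v rho -> rooted v rho' ->
    rho v = rho' v -> lin_equiv (x, rho) (x, rho') -> rho = rho'.
Proof.
move=> eul rc rc' ro ro' ev [n h].
(* In an Eulerian digraph a constant flow is balanced, so the turns can be normalised to vanish at
   [v]. Applying [rooted_no_turn] to the equivalence and to its inverse then gives equal ranks. *)
have h' k u : netflow (fun f =>
  (n (tail f) + k) + passed rho' f - passed rho f) u = 0.
  have /= := h u; rewrite -[X in X = _]addr0 => /addrI ->.
  rewrite -[RHS]addr0 -(netflow0 k u eul) -netflowD.
  by apply: eq_netflow => f; ring.
have H := rooted_no_turn (n := fun u =>
  n u - n v) rc' ro' ev (subrr (n v)) (h' (- n v)).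
have H' := @rooted_no_turn v rho' rho (fun u => - (n u - n v)) rc ro (esym ev).
rewrite subrr oppr0 in H'; have {}H' := H' erefl.
apply/ffunP=> u; apply: rank_out_inj; first by rewrite rc rc'.
have [] := H u; have [|] := H' _ u.
  move=> w; rewrite -[RHS]oppr0 -(h' (- n v) w) -netflowN.
  by apply: eq_netflow => f; ring.
by move=> a b c d; apply/eqP; rewrite eqn_leq b ?d //; lia.
Qed.

End RotorRouting.

(** * Existence of an outcome *)

Section Existence.
Variable D : ribbon_digraph.
Notation V := (vertex D).
Notation E := (edge D).
Implicit Types (rho : {ffun V -> E}) (x y z : config D) (s : state D).

Lemma rooted_arb v (T : {set E}) rho : in_arborescence v T ->
  (forall f, f \in T -> tail f != v -> f = rho (tail f)) -> rooted v rho.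
Proof.
move=> [_ conn] Trho C vC cl; apply/eqP/set0Pn => -[u uC].
case/connectP: (conn u) => p; elim: p u uC => [|w p IHp] u uC /=.
  by move=> _ vu; rewrite vu uC in vC.
case/andP=> /exists_inP[f fT /andP[/eqP fu /eqP fw]] pp vp.
apply: IHp pp vp; rewrite -fw (Trho f fT) fu; first exact: cl.
by apply: contraNneq vC => <-.
Qed.

Lemma rooted_connect v rho u : rooted v rho -> rotor_config rho ->
  connect (arc [set rho w | w in [set~ v]]) u v.
Proof.
move=> ro rc; set T := [set _ | w in _].
pose C := [set w | ~~ connect (arc T) w v].
suff C0 : C = set0.
  by apply/negPn/negP => nu; have : u \in C by [rewrite inE]; rewrite C0 inE.
apply: ro => [|w]; first by rewrite inE connect0.
rewrite !inE; apply: contra => hv; have [->|wv] := eqVneq w v;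
  first exact: connect0.
apply: connect_trans (connect1 _) hv; apply/exists_inP; exists (rho w).
  by apply: imset_f; rewrite !inE.
by rewrite rc !eqxx.
Qed.

(** Take a dart of the cycle whose edge has its tail of maximal rank. An edge of the cycle with its
    head there would have a tail of larger rank, and one with its tail there is the same edge. So
    the dart is its own neighbour, a loop, along which the rank cannot drop. *)
Lemma acyclic_of_rank (T : {set E}) (rank : V -> nat) :
    {in T &, injective tail} ->
    (forall e, e \in T -> (rank (head e) < rank (tail e))%N) ->
  forall c, ~~ graph_cycle T c.
Proof.
move=> injT dec c; apply/negP=> /and5P[c0 /allP cT cyc uc _].
have {c0} [d0 d0c] : exists d, d \in c.
  by case: c c0 {cT cyc uc} => // d c _; exists d; rewrite mem_head.
case: (arg_maxnP (fun d : E * bool => rank (tail d.1)) d0c) => d dc dmax.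
have up d' : d' \in c -> tail d.1 = dart_src d' \/ tail d.1 = dart_tgt d' -> d'
  = d.
  move=> d'c.
  have hd : tail d.1 = head d'.1 -> d' = d.
    by move=> dh; have := leq_trans (dec _ (cT _ d'c)) (dmax _ d'c);
      rewrite dh ltnn.
  have tl : tail d.1 = tail d'.1 -> d' = d.
    move=> dd; have e1 : d'.1 = d.1 by apply: injT => //; apply: cT.
    rewrite -(nth_index d d'c) -[RHS](nth_index d dc).
    congr nth; apply: (uniqP d.1 uc); rewrite ?inE ?size_map ?index_mem //.
    by rewrite !(nth_map d) ?index_mem // !nth_index.
  by rewrite /dart_src /dart_tgt; case: d'.2 => -[].
have loop : dart_src d != dart_tgt d.
  apply/eqP=> h; have := dec _ (cT _ dc); move: h.
  by rewrite /dart_src /dart_tgt; case: d.2 => ->; rewrite ltnn.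
have /eqP h1 := prev_cycle cyc dc; have /eqP h2 := next_cycle cyc dc.
have /up h3 : prev c d \in c by rewrite mem_prev.
have /up h4 : next c d \in c by rewrite mem_next.
have [] : tail d.1 = dart_src d \/ tail d.1 = dart_tgt d.
- by rewrite /dart_src /dart_tgt; case: d.2; [left|right].
- move=> h; have pd : prev c d = d by apply: h3; right; rewrite h1.
  by rewrite pd in h1; rewrite h1 eqxx in loop.
move=> h; have nd : next c d = d by apply: h4; left; rewrite -h2.
by rewrite nd in h2; rewrite h2 eqxx in loop.
Qed.

Lemma rooted_in_arborescence v rho : rooted v rho -> rotor_config rho ->
  in_arborescence v [set rho u | u in [set~ v]].
Proof.
move=> ro rc; set T := [set _ | u in _].
have conn u : connect (arc T) u v := rooted_connect u ro rc.
have TP f : f \in T -> tail f != v /\ f = rho (tail f).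
  by case/imsetP=> u; rewrite !inE => uv ->; rewrite rc.
split=> //; split.
  have sub a b : connect (arc T) a b -> connect (adj T) a b.
    by apply: connect_sub => {}a {}b ab; apply: connect1; apply/orP; left.
  have sym : connect_sym (adj T) by apply: sym_connect_sym => a b; apply: orbC.
  by move=> a b; apply: connect_trans (sub _ _ (conn a)) _; rewrite sym sub.
(* The rank is the distance to [v]. It drops along some edge of [T] leaving [u], and the rotor is
   the only such edge. *)
have [|rank _ rankP] := @connect_rank _ (fun a b => arc T b a) v.
  by move=> u; rewrite connect_rev; apply: conn.
apply: (@acyclic_of_rank T rank) => [f g /TP[_ ->] /TP[_ ->]|f fT].
  by rewrite !rc => ->.
have [fv fe] := TP f fT.
have [w /exists_inP[g gT /andP[/eqP gf /eqP gw]]] := rankP _ fv.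
by have [_ ge] := TP g gT; rewrite -gw ge gf -fe.
Qed.

(* Every cycle of rotors avoiding [v] carries a chip. *)
Definition guarded v s := (forall u, u != v -> 0 <= s.1 u) /\
  forall C : {set V}, v \notin C -> C != set0 ->
    (forall u, u \in C -> head (s.2 u) \in C) -> exists2 u, u \in C & 0 < s.1 u.

(** A closed set containing [u] contains the head of the new rotor, where the chip has landed. One
    avoiding [u] was closed before and loses no chip. *)
Lemma guarded_route v s u :
  u != v -> 0 < s.1 u -> guarded v s -> guarded v (route u s).
Proof.
move=> uv su [pos gu]; split=> [w wv|C vC C0 cl].
  rewrite ffunE; have := pos w wv; case: (eqVneq w u) => [->|_];
    case: eqP => /=; lia.
case uC: (u \in C).
  exists (head (nextout (s.2 u))).
    by have := cl u uC; rewrite ffunE eqxx.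
  have hC : head (nextout (s.2 u)) != v.
    by apply: contraNneq vC => <-; have := cl u uC; rewrite ffunE eqxx.
  rewrite ffunE eqxx; have := pos _ hC.
  by case: (eqVneq (head _) u) => [->|_] /=; lia.
have [w wC|w wC sw] := gu C vC C0.
  by have := cl w wC; rewrite ffunE; case: eqP => // wu; rewrite wu uC in wC.
exists w => //; rewrite ffunE.
have /negPf -> : w != u by apply: contraFneq uC => <-.
by case: eqP => /=; lia.
Qed.

Lemma foldl_fireE (l : seq V) x u :
  foldl (fun z v => fire v z) x l u =
  x u + netflow (fun f => (count_mem (tail f) l)%:Z) u.
Proof.
elim: l x => [|v l IHl] x /=.
  by rewrite /netflow !big1 // ?subr0 ?addr0.
rewrite IHl fireE -addrA -netflowD; congr (_ + _); apply: eq_netflow => f.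
by rewrite PoszD eq_sym.
Qed.

Lemma multiset_ex (g : V -> nat) : exists l, forall v, count_mem v l = g v.
Proof.
exists (flatten [seq nseq (g u) u | u <- enum V]) => v.
rewrite count_flatten sumnE 2!big_map big_enum /= (bigD1 v) //= count_nseq /=
  eqxx mul1n.
by rewrite big1 ?addn0 // => u /negPf uv; rewrite count_nseq /= uv.
Qed.

Hypothesis eul : eulerian D.
Hypothesis strong : forall u v : V, connect (arc [set: E]) u v.

(** Each vertex [u] fires [N * f u] times, with [f] growing towards [v] and [N] bounding all
    [|x u|]. Off [v] this gains at least [N] times the in-degree, hence at least [N] chips. *)
Lemma nonneg_firing_ex v x :
  exists2 y, firing_equiv x y & forall u, u != v -> 0 <= y u.
Proof.
have [|f _ fP] := @superharmonic_ex V E tail head v.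
  move=> u; apply: connect_sub (strong v u) => a b /exists_inP[e _ ab].
  by apply: connect1; apply/existsP; exists e.
have [N xN] : exists N : nat, forall u, `|x u| <= N%:Z.
  by exists (\sum_u `|x u|)%N => u;
    rewrite -abszE lez_nat (bigD1 u) //= leq_addr.
have [l lP] := multiset_ex (fun u => N * f u)%N.
exists (foldl (fun z v => fire v z) x l); first by exists l.
move=> u uv; rewrite foldl_fireE /netflow.
under eq_bigr do rewrite lP PoszM -[(f _)%:Z]natz.
under [X in _ - X]eq_bigr => e /eqP eu do rewrite lP eu PoszM.
rewrite -mulr_sumr -natr_sum natz sumr_const.
have := eul u; rewrite /indeg /outdeg !cardsE => <-.
have := fP u uv; rewrite sum_nat_const; set d := #|_|;
  set S := (\sum_(_ | _) _)%N.
have d0 : (0 < d)%N.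
  have /connectP[p] := strong v u; case/lastP: p => [|p w] /=.
    by move=> _ vu; rewrite vu eqxx in uv.
  rewrite rcons_path last_rcons => /andP[_ /exists_inP[e _ /andP[_ ew]]] wu.
  by apply/card_gt0P; exists e; rewrite wu.
move=> dS; rewrite -mulr_natr natz.
have : (N * (d * (f u).+1) <= N * S)%N by rewrite leq_mul2l dS orbT.
have : (N * 1 <= N * d)%N by rewrite leq_mul2l d0 orbT.
by have := xN u; nia.
Qed.

Lemma legal_routings_halt v s : rotor_config s.2 -> guarded v s ->
  exists s', [/\ legal_routings v s s', guarded v s' &
                 forall u, u != v -> s'.1 u = 0].
Proof.
have [|f fv fP] := @superharmonic_ex V E head tail v.
  move=> u; set R := [rel a b | _]; have /= <- := connect_rev R u v.
  apply: connect_sub (strong u v) => a b /exists_inP[e _ ab].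
  by apply: connect1; apply/existsP; exists e; rewrite andbC.
(* [h] is nonnegative and vanishes at [v]; the [k e] over the out-edges of any other vertex sum to
   at most 0. In [mu] the [passed] term offsets the change of [h] along the routed edge up to -1,
   and completing a turn adds at most 0. Thus each routing off [v] lowers [mu], which is bounded
   below on guarded states. *)
pose h u : int := (f v)%:Z - (f u)%:Z.
pose k e : int := h (head e) - h (tail e) + 1.
pose mu (s : state D) : int := \sum_u s.1 u * h u - \sum_e passed s.2 e * k e.
have hpos u : 0 <= h u by rewrite subr_ge0 lez_nat.
have mu_lb s' : guarded v s' -> 0 <= mu s' + \sum_e `|k e|.
  case=> pos _; rewrite -addrA addr_ge0 //.
    apply: sumr_ge0 => u _; have [->|uv] := eqVneq u v.
      by rewrite /h subrr mulr0.
    by rewrite mulr_ge0 ?pos.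
  rewrite addrC -sumrB sumr_ge0 // => e _; rewrite /passed.
  by case: (_ <= _)%N => /=; lia.
have mu_route s' u : u != v -> rotor_config s'.2 -> mu (route u s') < mu s'.
  move=> uv rc; have [b hb] := passed_route u rc.
  rewrite /mu.
  under eq_bigr do rewrite ffunE mulrDl mulrBl.
  under [X in _ - X]eq_bigr do rewrite hb mulrBl mulrDl.
  rewrite !big_split /= !sumrN.
  have one (T : finType) (a : T) (g : T -> int) : \sum_i (i == a)%:Z * g i = g
    a.
    by rewrite (bigD1 a) //= eqxx mul1r big1 ?addr0 // => i /negPf ->;
      rewrite mul0r.
  rewrite !one.
  have kb : \sum_i (b && (tail i == u))%:Z * k i <= 0.
    case: b {hb}; last by rewrite big1 // => i _; rewrite mul0r.
    rewrite (_ : \sum_i _ = \sum_(i | tail i == u) ((f u).+1%:Z - (f (head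
      i))%:Z)).
      by rewrite sumrB subr_le0 -!(big_morph Posz PoszD (erefl _)) lez_nat fP.
    rewrite [RHS]big_mkcond; apply: eq_bigr => i _ /=.
    by case: eqP => [iu|_]; rewrite ?mul0r // mul1r /k /h iu -addn1 PoszD; ring.
  rewrite [k _]/k tail_nextout rc; lra.
move: s; suff H (n : nat) s : mu s + \sum_e `|k e| < n%:Z -> rotor_config s.2 ->
    guarded v s -> exists s', [/\ legal_routings v s s', guarded v s' &
                 forall u, u != v -> s'.1 u = 0].
  move=> s rc gu; pose n := (absz (mu s + \sum_e `|k e|)).+1.
  by apply: (H n s) => //; rewrite /n; lia.
elim: n s => [|n IHn] s lt rc gu; first by have := mu_lb s gu; lia.
case: (pickP (fun u => (u != v) && (s.1 u != 0))) => [u /andP[uv su]|s0].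
  have su0 : 0 < s.1 u by rewrite lt_neqAle eq_sym su; apply: gu.1.
  have [||s' [ls gs zs]] := IHn (route u s) _ (rotor_config_route u rc).
  - by have := mu_route s u uv rc; lia.
  - exact: guarded_route.
  by exists s'; split=> //; apply: legal_step ls.
exists s; split=> // [|u uv]; first exact: legal_refl.
by have := s0 u; rewrite uv /= => /negbFE/eqP.
Qed.

Lemma rotor_outcome_ex v (X : sandpile D) (T : arb v) rho :
    rotor_config rho -> [set rho u | u : V] = rho v |: T ->
  exists T', rotor_outcome X T T'.
Proof.
move=> rc rT; have [x0 _ Xx0] := sandpileP X.
have [x xx0 xpos] := nonneg_firing_ex v x0.
have ro : rooted v rho.
  apply: rooted_arb (arbP T) _ => f fT fv.
  have : f \in rho v |: T by rewrite inE fT orbT.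
  by rewrite -rT => /imsetP[u _ ->]; rewrite rc.
have gu : guarded v (x, rho).
  split=> // C vC C0 cl; case/eqP: C0; exact: ro.
have [[y rho'] [lr gy y0]] := legal_routings_halt (s := (x, rho)) rc gu.
have [_ /= rc' _] := legal_routings_lin_equiv lr rc.
(* A nonempty closed set avoiding [v] would carry a chip, but no chip is left there. *)
have ro' : rooted v rho'.
  move=> C vC cl; apply/eqP; apply/negPn/negP => C0.
  have [u uC] := gy.2 C vC C0 cl; rewrite y0 ?ltxx //.
  by apply: contraNneq vC => <-.
exists (Arb (rooted_in_arborescence ro' rc')), x, y, rho, rho', (rho v).
by split=> //; split=> //; apply/Xx0.
Qed.

End Existence.

(** * The rotor-routing action in terms of linear equivalence *)

Section RotorAction.
Variable D : ribbon_digraph.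
Notation V := (vertex D).
Notation E := (edge D).
Implicit Types (rho tau : {ffun V -> E}) (x y z : config D) (X : sandpile D).

Lemma arb_inj v (T T' : arb v) : T = T' :> {set E} -> T = T'.
Proof.
by case: T T' => [T aT] [T' aT'] /= eT; subst T';
  rewrite (proof_irrelevance _ aT aT').
Qed.

Definition rotors_off v rho : {set E} := [set rho u | u in [set~ v]].

Lemma rotors_offU v rho : [set rho u | u : V] = rho v |: rotors_off v rho.
Proof.
apply/setP=> f; apply/imsetP/setU1P => [[u _ ->]|[->|/imsetP[u _ ->]]].
- have [->|uv] := eqVneq u v; first by left.
  by right; apply/imset_f; rewrite !inE.
- by exists v.
- by exists u.
Qed.

Lemma mem_rotors_off v rho f : rotor_config rho -> f \in rotors_off v rho ->
  f = rho (tail f).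
Proof. by move=> rc /imsetP[u _ ->]; rewrite rc. Qed.

Lemma rotors_off_rooted v (T : arb v) rho :
  rotor_config rho -> T = rotors_off v rho :> {set E} -> rooted v rho.
Proof.
move=> rc Trho; apply: rooted_arb (arbP T) _ => f.
by rewrite Trho => /mem_rotors_off-/(_ rc).
Qed.

Lemma sum_sandpile X x : X x -> \sum_v x v = 0.
Proof.
have [x0 sx0 Xx0] := sandpileP X; move/Xx0 => [l ->].
elim: l x0 sx0 {Xx0} => //= v l IHl x0 sx0; apply: IHl.
by under eq_bigr do rewrite fireE; rewrite big_split /= sx0 sum_netflow.
Qed.

Lemma sandpile_lin_equiv X x y rho : X x -> X y -> lin_equiv (x, rho) (y, rho).
Proof.
have [x0 _ Xx0] := sandpileP X => /Xx0 x0x /Xx0 x0y.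
apply: lin_equiv_trans (lin_equiv_fires rho x0y).
exact/lin_equiv_sym/lin_equiv_fires.
Qed.

Lemma rotor_outcome_lin_equiv v X (T T' : arb v) tau tau' :
    rotor_outcome X T T' -> rotor_config tau -> rotor_config tau' ->
    T = rotors_off v tau :> {set E} -> T' = rotors_off v tau' :> {set E} ->
    tau v = tau' v ->
  exists2 x, X x & lin_equiv (x, tau) (0, tau').
Proof.
case=> x [y [rho [rho' [e [[Xx _] ev [rc rT] [lr y0] T'rho']]]]] ct ct' Tt Tt'
  ett.
have [le /= rc' ve] := legal_routings_lin_equiv lr rc.
(* Chips are conserved and their total is 0, so with none off [v] there is none at [v] either. *)
have y00 : y = 0.
  apply/ffunP=> u; rewrite ffunE; have [->|] := eqVneq u v; last exact: y0.
  have := sum_lin_equiv le;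
    rewrite /= (sum_sandpile Xx) (bigD1 v) //= big1 ?addr0 //.
exists x => //; rewrite -y00;
  apply: (lin_equiv_root (v := v) _ _ _ _ le) => // u uv.
- have : tau u \in [set rho w | w : V].
    by rewrite rT inE Tt imset_f ?orbT // !inE.
  by case/imsetP=> w _ tw; rewrite tw -(ct u) tw rc.
- have : tau' u \in rotors_off v rho'.
    by rewrite /rotors_off -T'rho' Tt' imset_f // !inE.
  by move/(mem_rotors_off rc') ->; rewrite ct'.
Qed.

Hypothesis eul : eulerian D.
Hypothesis strong : forall u v : V, connect (arc [set: E]) u v.

Lemma rotor_actionP v X (T : arb v) rho :
    rotor_config rho -> T = rotors_off v rho :> {set E} ->
  rotor_outcome X T (rotor_action X T).
Proof.
move=> rc Trho; apply: epsilon_spec; apply: rotor_outcome_ex rc _ => //.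
by rewrite Trho; apply: rotors_offU.
Qed.

(** The actual outcome and [T'] are both equivalent to the same start, hence to each other with
    equal chips and root rotors; uniqueness applies. *)
Lemma rotor_action_eq v X (T T' : arb v) x rho rho' :
    rotor_config rho -> rotor_config rho' ->
    T = rotors_off v rho :> {set E} -> T' = rotors_off v rho' :> {set E} ->
    rho v = rho' v -> X x -> lin_equiv (x, rho) (0, rho') ->
  rotor_action X T = T'.
Proof.
move=> rc rc' Trho T'rho' ev Xx le.
have out := rotor_actionP X rc Trho; set T2 := rotor_action X T in out *.
(* [tau] completes [T2] by [rho v], since the run producing [T2] may have used another rotor at the
   root. *)
have [tau ct [T2t tv]] : exists2 tau, rotor_config tau &
    T2 = rotors_off v tau :> {set E} /\ rho v = tau v.
  case: out => x1 [y [r0 [r [_ [_ _ [rc0 _] [lr _] T2r]]]]].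
  have [_ /= rcr _] := legal_routings_lin_equiv lr rc0.
  exists [ffun u => if u == v then rho v else r u]; last split.
  - by move=> u; rewrite ffunE; case: eqP => [->|].
  - rewrite T2r; apply: eq_in_imset => u; rewrite !inE ffunE.
    by move/negPf ->.
  - by rewrite ffunE eqxx.
have [x' Xx' le'] := rotor_outcome_lin_equiv out rc ct Trho T2t tv.
apply: arb_inj; rewrite T2t T'rho'; congr rotors_off.
apply: (@rooted_lin_equiv_inj _ v 0) => //.
- exact: rotors_off_rooted T2t.
- exact: rotors_off_rooted T'rho'.
- by rewrite -tv ev.
apply: lin_equiv_trans le; apply: lin_equiv_trans (lin_equiv_sym le') _.
exact: sandpile_lin_equiv Xx' Xx.
Qed.

End RotorAction.

(** * Following a compatible tour with one chip *)

Lemma orbit_next (T : finType) (p : {perm T}) x :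
  orbit p (p x) = rot 1 (orbit p x).
Proof.
have ex : order p (p x) = order p x.
  by apply: eq_card => y; rewrite !inE -same_fconnect1 //; apply: perm_inj.
rewrite /orbit ex; have := iter_order (@perm_inj _ p) x.
case: (order p x) => //= n px;
  rewrite rot1_cons -[X in rcons _ X]px -iterS iterSr.
by rewrite -trajectSr.
Qed.

Section Tours.
Variable D : ribbon_digraph.
Notation V := (vertex D).
Notation E := (edge D).
Hypothesis conn : weakly_connected D.
Implicit Types (t : euler_tour D) (e f : E).

Lemma out_edge_ex t e (u : V) : exists f, tail f = u.
Proof.
have [->|ue] := eqVneq u (tail e); first by exists e.
by have [f _ fu] := last_exits_cover t conn ue; exists f.
Qed.

(** The tour itself, followed from an out-edge of [u] to an out-edge of [v], is a directed walk. *)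
Lemma tour_strong t e (u v : V) : connect (arc [set: E]) u v.
Proof.
have [f <-] := out_edge_ex t e u; have [g <-] := out_edge_ex t e v.
have := tour_transitive t f g; rewrite -fconnect_orbit => /iter_findex <-.
elim: (findex _ _ _) => [|n IHn] /=; first exact: connect0.
apply: connect_trans IHn (connect1 _); apply/exists_inP.
by exists (iter n (tour_next t) f); rewrite ?inE // (tour_chain t) !eqxx.
Qed.

(* The last out-edges traversed by [t] when it has just traversed [e]. *)
Definition exits t e : {ffun V -> E} :=
  [ffun v => last e [seq f <- reading t (tour_next t e) | tail f == v]].

Lemma reading_cons t e : exists2 s, reading t e = e :: s &
  reading t (tour_next t e) = rcons s e.
Proof.
rewrite /reading orbit_next /orbit -orderSpred /=.
by eexists; first by []; rewrite rot1_cons.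
Qed.

Lemma exits_tail t e : exits t e (tail e) = e.
Proof.
have [s _] := reading_cons t e; rewrite ffunE => ->.
by rewrite filter_rcons eqxx last_rcons.
Qed.

Lemma exits_off t e v : v != tail e ->
  exits t e v \in last_exits t e /\ tail (exits t e v) = v.
Proof.
move=> ve; have [f fT fv] := last_exits_cover t conn ve.
suff -> : exits t e v = f by [].
have := mem_reading t e f; move: fT; rewrite inE fv ffunE => /andP[_ /eqP].
have [s -> ->] := reading_cons t e.
rewrite filter_rcons /= eq_sym (negPf ve) inE => lf /predU1P[fe|fs].
  by rewrite -fv fe eqxx in ve.
(* The list is nonempty, so [last] returns the same edge from either default. *)
have : f \in [seq g <- s | tail g == v] by rewrite mem_filter fv eqxx.
by case: [seq g <- s | _] lf.
Qed.

Lemma rotor_config_exits t e : rotor_config (exits t e).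
Proof.
move=> v; have [->|ve] := eqVneq v (tail e); first by rewrite exits_tail.
by have [] := exits_off t ve.
Qed.

Lemma last_exits_rotors_off t e :
  last_exits t e = rotors_off (tail e) (exits t e).
Proof.
apply/setP=> f; apply/idP/imsetP => [fT|[u]].
  have [fe _] := mem_last_exits fT; exists (tail f); first by rewrite !inE.
  have [gT gf] := exits_off t fe.
  exact: last_exits_tail_inj fT gT (esym gf).
by rewrite in_setC1 => /(exits_off t)[uT _] ->.
Qed.

(** In the reading from [tour_next t e], the out-edges at its tail begin with this edge and end with
    the last exit, whose cyclic successor is therefore the first. *)
Lemma nextout_exits t e : compatible t ->
  nextout (exits t e (tail (tour_next t e))) = tour_next t e.
Proof.
move=> comp; set f := tour_next t e; set g := exits t e _.
have gt : tail g = tail f by apply: rotor_config_exits.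
rewrite -comp gt; have /orbit_perm_rot[i] := mem_reading t f g.
rewrite /reading => ->; have [j ->] := filter_rot (fun h =>
  tail h == tail f) i (reading t f).
rewrite next_rot; last by rewrite filter_uniq // uniq_reading.
have u := filter_uniq (fun h => tail h == tail f) (uniq_reading t f).
move: u; rewrite /g ffunE -/f; case: (reading_cons t f) => s -> _.
have -> : [seq h <- f :: s | tail h == tail f] = f :: [seq h <- s | tail h ==
  tail f].
  by rewrite /= eqxx.
by move=> u; rewrite [last _ _]/= next_last.
Qed.

Definition chip (v : V) : config D := [ffun u => (u == v)%:Z].

(** Traversing one more edge changes the last exit only at its tail, exactly as routing the chip
    there does. *)
Lemma route_exits t e : compatible t ->
  route (head e) (chip (head e), exits t e) =
  (chip (head (tour_next t e)), exits t (tour_next t e)).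
Proof.
move=> comp; rewrite (tour_chain t) /route /= nextout_exits //; congr (_, _).
  by apply/ffunP=> u; rewrite !ffunE subrr add0r.
apply/ffunP=> u; set f := tour_next t e; rewrite ffunE.
case: eqP => [->|/eqP uf]; first by rewrite exits_tail.
have := rotor_config_exits t f u; have [s e1 e2] := reading_cons t f.
rewrite !ffunE -/f e1 e2 filter_rcons /= eq_sym (negPf uf).
case: [seq _ <- s | _] => //= fu.
by rewrite -fu eqxx in uf.
Qed.

Lemma lin_equiv_exits t e f : compatible t ->
  lin_equiv (chip (head e), exits t e) (chip (head f), exits t f).
Proof.
move=> comp; have := tour_transitive t e f.
rewrite -fconnect_orbit => /iter_findex <-.
elim: (findex _ _ _) => [|n IHn] /=; first exact: lin_equiv_refl.
apply: lin_equiv_trans IHn _; rewrite -route_exits //.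
exact/lin_equiv_route/rotor_config_exits.
Qed.

End Tours.

(** * Moving the equivalence from one root edge to another *)

Theorem theorem3p1 (D : ribbon_digraph)
    (conn : weakly_connected D) (eul : eulerian D)
    (uv wz : edge D) (x : sandpile D)
    (t t' : euler_tour D) (comp_t : compatible t) (comp_t' : compatible t') :
  rotor_action x (tour_arb conn uv t) = tour_arb conn uv t' ->
  rotor_action x (tour_arb conn wz t) = tour_arb conn wz t'.
Proof.
move=> act; have strong := tour_strong conn t uv.
have rc e s : rotor_config (exits s e) := rotor_config_exits conn s e.
have Te e s : tour_arb conn e s = rotors_off (tail e) (exits s e) :> {set _} :=
  last_exits_rotors_off conn s e.
have rootE e : exits t e (tail e) = exits t' e (tail e) by rewrite !exits_tail.
have := rotor_actionP eul strong x (rc uv t) (Te uv t); rewrite act => out.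
have [y xy yuv] := rotor_outcome_lin_equiv out (rc _ _) (rc _ _) (Te _ _) (Te _
  _) (rootE uv).
apply: (rotor_action_eq eul strong (rc _ _) (rc _ _) (Te _ _) (Te _ _) (rootE
  wz) xy).
have mv s : compatible s -> lin_equiv (chip (head wz), exits s wz) (chip (head
  uv), exits s uv).
  exact: lin_equiv_exits.
(* A chip is added at [head uv]; together with the rotors it is carried along [t] from [wz] to [uv]
   before the equivalence, and along [t'] back to [wz] after it. The chip, now at [head wz] on both
   sides, is then removed. *)
have := lin_equiv_shift (chip (head uv)) yuv; rewrite add0r [y + _]addrC =>
  yuv'.
have := lin_equiv_shift y (mv t comp_t).
move=> /lin_equiv_trans /(_ yuv') /lin_equiv_trans /(_ (lin_equiv_sym (mv t'
  comp_t'))).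
by move/(lin_equiv_shift (- chip (head wz))); rewrite subrr addrAC subrr add0r.
Qed.
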